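(* Let $F$ be a strongly symmetric norm on $\mathbb{R}^2$. Then the smallest value of $\delta_F(\alpha)$, as $\alpha$ ranges over all well approximable real numbers, is $\Delta_F$ (that is, $\delta_F(\alpha)\ge \Delta_F$ for every well approximable $\alpha$, and equality holds for some well approximable $\alpha$).
   Context: A norm $F$ on $\mathbb{R}^2$ is strongly symmetric if $F(x,y)=F(|x|,|y|)$ for all $(x,y)\in\mathbb{R}^2$ and $F(0,\pm1)=F(\pm1,0)=1$. For $t>0$ put $F_t(x,y)=F(t^{-1}x,ty)$. Let $\mathcal{B}=\{P\in\mathbb{R}^2:F(P)<1\}$ and let $\Delta=\Delta_F$ be the minimal area of a parallelogram with one vertex at the origin and the other three vertices on the boundary of $\mathcal{B}$. For irrational $\alpha$, $\delta_F(\alpha)$ denotes the largest real number with the following property: if $c>\delta_F(\alpha)$ then for every sufficiently large real $t$ there exist integers $p,q$ with $q>0$ and $\Delta\,F_t(q,p-\alpha q)^2<c$, while if $c<\delta_F(\alpha)$ there are arbitrarily large $t$ for which no such $p,q$ exist. An irrational $\alpha$ is badly approximable if there is $c>0$ with $|\alpha-\frac pq|>\frac{c}{q^2}$ for all coprime integers $p,q$ with $q>0$; an irrational $\alpha$ is well approximable if it is not badly approximable. *)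

(* Defs.v *)
From HB Require Import structures.
From mathcomp Require Import all_boot all_order all_algebra.
From mathcomp Require Import all_classical all_reals all_analysis.

Set Implicit Arguments.
Unset Strict Implicit.
Unset Printing Implicit Defensive.

Import Order.TTheory GRing.Theory Num.Theory.
Import numFieldNormedType.Exports.

Local Open Scope classical_set_scope.
Local Open Scope ring_scope.

(* Nonnegativity of [F] follows from the three axioms. *)
Definition is_norm (R : realType) (F : R * R -> R) : Prop :=
  [/\ forall P Q : R * R, F (P + Q) <= F P + F Q,
      forall (a : R) (P : R * R), F (a *: P) = `|a| * F P
    & forall P : R * R, F P = 0 -> P = 0].

Definition strongly_symmetric (R : realType) (F : R * R -> R) : Prop :=
  (forall x y : R, F (x, y) = F (`|x|, `|y|)) /\
  [/\ F (0, 1) = 1, F (0, -1) = 1, F (1, 0) = 1 & F (-1, 0) = 1].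

Definition F_t (R : realType) (F : R * R -> R) (t : R) (P : R * R) : R :=
  F (t^-1 * P.1, t * P.2).

Definition unit_disk (R : realType) (F : R * R -> R) : set (R * R) :=
  [set P | F P < 1].

Definition boundary (T : topologicalType) (A : set T) : set T :=
  closure A `\` interior A.

Definition det2 (R : realType) (P Q : R * R) : R := P.1 * Q.2 - P.2 * Q.1.

(* The areas of the nondegenerate parallelograms 0, P, P + Q, Q all of whose
   vertices other than the origin lie on the boundary of the unit disk. *)
Definition parallelogram_areas (R : realType) (F : R * R -> R) : set R :=
  [set a | exists P Q : R * R,
     [/\ boundary (unit_disk F) P, boundary (unit_disk F) Q,
         boundary (unit_disk F) (P + Q), det2 P Q != 0 & a = `|det2 P Q|]].

(* For a norm [F] this infimum is attained, by compactness. *)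
Definition Delta (R : realType) (F : R * R -> R) : R :=
  inf (parallelogram_areas F).

Definition has_solution (R : realType) (F : R * R -> R) (alpha c t : R) : Prop :=
  exists p q : int,
    0 < q /\ Delta F * F_t F t (q%:~R, p%:~R - alpha * q%:~R) ^+ 2 < c.

Definition delta_property (R : realType) (F : R * R -> R) (alpha d : R) : Prop :=
  (forall c : R, d < c -> \forall t \near +oo, has_solution F alpha c t) /\
  (forall c : R, c < d ->
     forall T : R, exists t : R, T < t /\ ~ has_solution F alpha c t).

(* The two halves of [delta_property] make its solution [d] unique, and
   Dirichlet's theorem gives existence, so [sup] is taken over a singleton. *)
Definition delta (R : realType) (F : R * R -> R) (alpha : R) : R :=
  sup [set d | delta_property F alpha d].

Definition badly_approximable (R : realType) (alpha : R) : Prop :=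
  irrational alpha /\
  exists c : R, 0 < c /\
    forall p q : int, coprimez p q -> 0 < q ->
      `|alpha - p%:~R / q%:~R| > c / q%:~R ^+ 2.

Definition well_approximable (R : realType) (alpha : R) : Prop :=
  irrational alpha /\ ~ badly_approximable alpha.

(* Main.v *)
Require Import Defs.
From HB Require Import structures.
From mathcomp Require Import all_boot all_order all_algebra.
From mathcomp Require Import all_classical all_reals all_analysis.
From mathcomp Require Import lra ring zify.

(** A strongly symmetric norm satisfies max(|x|, |y|) <= F(x, y) <= |x| + |y|,
    and [delta F alpha] is [Delta F] times the limsup, as t tends to infinity,
    of the squared minimum of F over the points (q / t, t (p - alpha q)), q > 0.

    If alpha is well approximable, take t = q for a fraction p/q with
    q |p - alpha q| small: the lattice then contains a vector close to (1, 0)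
    and, having determinant 1, no point much shorter in the sup norm, so the
    limsup is at least 1.  Conversely, if the partial quotients of alpha tend
    to infinity and q_k <= t <= q_(k+1), the k-th convergent has l1 norm at most
    1 + q_k / q_(k+1), which tends to 1; alpha = [0; 2, 3, 4, ...] will do.
    The value of [Delta F] plays no role beyond [0 <= Delta F]. *)

Set Implicit Arguments.
Unset Strict Implicit.
Unset Printing Implicit Defensive.

Import Order.TTheory GRing.Theory Num.Theory.
Import numFieldNormedType.Exports.

Local Open Scope classical_set_scope.
Local Open Scope ring_scope.

(** * Comparison of [F] with the sup and l1 norms *)

Section StronglySymmetricNorm.
Variables (R : realType) (F : R * R -> R).
Hypotheses (F_norm : is_norm F) (F_sym : strongly_symmetric F).

Lemma norm_axis1 (x : R) : F (x, 0) = `|x|.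
Proof.
have [_ FZ _] := F_norm; have [_ [_ _ F10 _]] := F_sym.
have -> : (x, 0) = x *: ((1, 0) : R * R).
  by congr pair; rewrite /= /GRing.scale /= ?mulr1 ?mulr0.
by rewrite FZ F10 mulr1.
Qed.

Lemma norm_axis2 (y : R) : F (0, y) = `|y|.
Proof.
have [_ FZ _] := F_norm; have [_ [F01 _ _ _]] := F_sym.
have -> : (0, y) = y *: ((0, 1) : R * R).
  by congr pair; rewrite /= /GRing.scale /= ?mulr1 ?mulr0.
by rewrite FZ F01 mulr1.
Qed.

Lemma norm_le_l1 (x y : R) : F (x, y) <= `|x| + `|y|.
Proof.
have [FD _ _] := F_norm.
have -> : (x, y) = ((x, 0) : R * R) + (0, y).
  by rewrite /GRing.add /= /add_pair /= addr0 add0r.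
by rewrite (le_trans (FD _ _))// norm_axis1 norm_axis2.
Qed.

(** Reflection in the first axis preserves [F], and a point and its mirror image add up to (2x,
    0). *)
Lemma norm_ge1 (x y : R) : `|x| <= F (x, y).
Proof.
have [FD _ _] := F_norm; have [Fabs _] := F_sym.
have := FD (x, y) (x, - y).
have -> : ((x, y) : R * R) + (x, - y) = (x + x, 0).
  by rewrite {1}/GRing.add /= /add_pair /= subrr.
rewrite norm_axis1 (Fabs x (- y)) normrN -Fabs -mulr2n normrMn -mulr2n.
by rewrite lerMn2r.
Qed.

Lemma norm_ge2 (x y : R) : `|y| <= F (x, y).
Proof.
have [FD _ _] := F_norm; have [Fabs _] := F_sym.
have := FD (x, y) (- x, y).
have -> : ((x, y) : R * R) + (- x, y) = (0, y + y).
  by rewrite {1}/GRing.add /= /add_pair /= subrr.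
rewrite norm_axis2 (Fabs (- x) y) normrN -Fabs -mulr2n normrMn -mulr2n.
by rewrite lerMn2r.
Qed.

End StronglySymmetricNorm.

(** * Existence and uniqueness of the value of [delta] *)

Lemma Delta_ge0 (R : realType) (F : R * R -> R) : 0 <= Delta F.
Proof.
rewrite /Delta; have [->|/set0P ne] := eqVneq (parallelogram_areas F) set0.
  by rewrite inf0.
by apply: lb_le_inf => // a [P [Q [_ _ _ _ ->]]].
Qed.

Lemma delta_property_unique (R : realType) (F : R * R -> R) (alpha d d' : R) :
  delta_property F alpha d -> delta_property F alpha d' -> d = d'.
Proof.
suff le (a b : R) : delta_property F alpha a -> delta_property F alpha b ->
    b <= a.
  by move=> da db; apply/eqP; rewrite eq_le !le.
move=> [ha _] [_ hb]; rewrite leNgt; apply/negP => ab.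
have /ha [M [_ sol]] : a < (a + b) / 2 by lra.
have /hb /(_ M) [t [Mt]] : (a + b) / 2 < b by lra.
by apply; apply: sol.
Qed.

Lemma deltaE (R : realType) (F : R * R -> R) (alpha d : R) :
  delta_property F alpha d -> delta F alpha = d.
Proof.
move=> dP; rewrite /delta -[RHS]sup1; congr sup.
apply/seteqP; split=> [e eP|e ->//].
exact: delta_property_unique eP dP.
Qed.

(** Pigeonhole: the fractional parts of the multiples 0, ..., [N] of [alpha] fall into [N] boxes of
    length 1/N. *)
Lemma dirichlet (R : realType) (alpha : R) (N : nat) : (0 < N)%N ->
  exists p q : int, [/\ 0 < q, q <= N%:Z &
    `|p%:~R - alpha * q%:~R| <= N%:R^-1].
Proof.
move=> N0; have N0r : 0 < N%:R :> R by rewrite ltr0n.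
pose fr (i : 'I_N.+1) : R := alpha * i%:R - (Num.floor (alpha * i%:R))%:~R.
have fr0 i : 0 <= fr i < 1.
  rewrite /fr; have /andP[] := floor_itv (alpha * i%:R); rewrite intrD => *.
  by apply/andP; split; lra.
have box i : (Num.trunc (N%:R * fr i) < N)%N.
  have /andP[f0 f1] := fr0 i.
  have /truncn_itv/andP[tl _] : 0 <= N%:R * fr i by rewrite mulr_ge0// ltW.
  rewrite -(ltr_nat R) (le_lt_trans tl)// -[ltRHS]mulr1 ltr_pM2l//.
pose f i : 'I_N := Ordinal (box i).
have : ~~ injectiveb f.
  apply/negP => /injectiveP /leq_card; rewrite !card_ord; lia.
case/injectivePn => i [j ij fij].
wlog {ij} ltij : i j fij / (i < j)%N.
  move=> H; move: (ij); rewrite -val_eqE /= neq_ltn => /orP[|]; first exact: H.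
  by apply: H.
have close : `|fr j - fr i| <= N%:R^-1.
  have /andP[fi0 _] := fr0 i; have /andP[fj0 _] := fr0 j.
  have eT : Num.trunc (N%:R * fr i) = Num.trunc (N%:R * fr j).
    exact: (congr1 val fij).
  have /truncn_itv : 0 <= N%:R * fr i by rewrite mulr_ge0// ltW.
  have /truncn_itv : 0 <= N%:R * fr j by rewrite mulr_ge0// ltW.
  rewrite eT -natr1 => /andP[a1 a2] /andP[b1 b2].
  rewrite -[leRHS]mulr1 ler_pdivlMl// -{1}(gtr0_norm N0r) -normrM ler_norml.
  by apply/andP; split; lra.
exists (Num.floor (alpha * j%:R) - Num.floor (alpha * i%:R)), (j%:Z - i%:Z).
split; [lia | have := ltn_ord j; lia |].
rewrite distrC; congr (`|_| <= _): close.
rewrite /fr !intrB -!pmulrn; ring.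
Qed.

Section DeltaProperty.
Variables (R : realType) (F : R * R -> R).
Hypotheses (F_norm : is_norm F) (F_sym : strongly_symmetric F).

Lemma has_solution_gt0 (alpha c t : R) : has_solution F alpha c t -> 0 < c.
Proof.
move=> [p [q [_]]]; apply: le_lt_trans.
by rewrite mulr_ge0// ?Delta_ge0// sqr_ge0.
Qed.

(** The value is the infimum of the set [E] of eventually solvable [c], which is upward closed and
    bounded below by 0; Dirichlet's theorem makes it nonempty. *)
Lemma delta_property_exists (alpha : R) : exists d, delta_property F alpha d.
Proof.
have D0 := Delta_ge0 F.
pose E := [set c : R | \forall t \near +oo, has_solution F alpha c t].
(* For [N] the integer part of [t], Dirichlet's theorem gives |x| <= 1 and |y| <= t/N <= 2, so F^2
   <= 9; the added 1 gives strictness. *)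
have E1 : E (9 * Delta F + 1).
  exists 1; split=> // t t1.
  have t0 : 0 < t by lra.
  have /andP[] := truncn_itv (ltW t0); set N := Num.trunc t => Nt tN.
  have N0 : (0 < N)%N.
    by case: (N) tN => //; rewrite ltNge ltW.
  have [p [q [q0 qN ap]]] := dirichlet alpha N0.
  exists p, q; split=> //; rewrite /F_t /=.
  set x := t^-1 * _; set y := t * _.
  have N1 : 1 <= N%:R :> R by rewrite ler1n.
  have qr0 : 0 < q%:~R :> R by rewrite ltr0z.
  have qr : q%:~R <= N%:R :> R by rewrite -[leRHS]/(N%:Z%:~R) ler_int.
  have hx : `|x| <= 1.
    rewrite /x ger0_norm; last by rewrite mulr_ge0 ?invr_ge0 ?ltW.
    by rewrite ler_pdivrMl// mulr1 (le_trans qr).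
  have hy : `|y| <= 2.
    rewrite /y normrM gtr0_norm//.
    apply: (@le_trans _ _ (t * N%:R^-1)); first by rewrite ler_pM2l.
    rewrite ler_pdivrMr; last lra.
    move: tN; rewrite -natr1; lra.
  have h1 := norm_le_l1 F_norm F_sym x y.
  have h0 := le_trans (normr_ge0 _) (norm_ge1 F_norm F_sym x y).
  have : F (x, y) ^+ 2 <= 9 by nra.
  nra.
have E0 : lbound E 0.
  move=> c [M [_ sol]]; apply/ltW/(@has_solution_gt0 alpha c (M + 1)).
  by apply: sol; rewrite ltrDl.
have up c : inf E < c -> E c.
  move=> /(inf_lt (ex_intro _ _ E1)) [e [M [Mr sol]] ec].
  exists M; split=> // t /sol [p [q [q0 h]]].
  by exists p, q; split=> //; exact: lt_trans ec.
exists (inf E); split=> // c cE T.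
apply: contrapT => nt.
suff /(ge_inf (ex_intro _ _ E0)) : E c by rewrite leNgt cE.
exists T; split=> [|t Tt]; first exact: num_real.
by apply: contrapT => ns; apply: nt; exists t.
Qed.

Lemma delta_propertyP (alpha : R) : delta_property F alpha (delta F alpha).
Proof. by have [d dP] := delta_property_exists alpha; rewrite (deltaE dP). Qed.

End DeltaProperty.

(** * The lower bound for well approximable numbers *)

(** Used to force very good approximations to have large denominators. *)
Lemma irrational_dist (R : realType) (alpha : R) (N : nat) : irrational alpha ->
  exists m : R, 0 < m /\ forall p q : int, 0 < q -> q <= N%:Z ->
    m <= `|p%:~R - alpha * q%:~R|.
Proof.
move=> irr; elim: N => [|N [m [m0 IH]]].
  by exists 1; split=> // p q *; exfalso; lia.
pose x := alpha * N.+1%:R; pose k := Num.floor x.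
have /andP[kx xk] := floor_itv x; rewrite -/k in kx xk.
have xNk : k%:~R != x.
  apply/eqP => e; apply: irr; exists (k%:~R / N.+1%:R) => //.
  by rewrite rmorphM /= fmorphV /= ratr_int ratr_nat e /x mulfK.
have {}kx : k%:~R < x by rewrite lt_neqAle xNk.
(* The integers [k] and [k + 1] enclose the non-integer [x], so these two gaps handle the new
   denominator. *)
exists (Num.min m (Num.min (x - k%:~R) ((k + 1)%:~R - x))).
split; first by rewrite !lt_min m0 !subr_gt0 kx xk.
move=> p q q0 qN; have [e|qN'] := eqVneq q N.+1%:Z; last first.
  rewrite ge_min IH//; lia.
rewrite e -pmulrn -/x !ge_min.
have [pk|kp] := leP p k.
  have h : p%:~R <= k%:~R :> R by rewrite ler_int.
  apply/orP; right; apply/orP; left.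
  by rewrite distrC (le_trans _ (ler_norm _))// lerD2l lerN2.
have h : (k + 1)%:~R <= p%:~R :> R by rewrite ler_int; lia.
apply/orP; right; apply/orP; right.
by rewrite (le_trans _ (ler_norm _))// lerD2r.
Qed.

Lemma well_approximable_good (R : realType) (alpha eta T : R) :
  well_approximable alpha -> 0 < eta ->
  exists p q : int, [/\ coprimez p q, 0 < q, T < q%:~R &
    q%:~R * `|p%:~R - alpha * q%:~R| <= eta].
Proof.
move=> [irr nbad] eta0.
pose N := Num.trunc T.
have [m [m0 mP]] := irrational_dist N irr.
apply: contrapT => none; apply: nbad; split=> //.
(* If no such fraction existed, this constant would make [alpha] badly approximable: [eta] serves
   for q > N, and [m / 2] for q <= N, halved for strictness. *)
exists (Num.min eta (m / 2)); split; first by rewrite lt_min eta0 divr_gt0.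
move=> p q cop q0; have qr0 : 0 < q%:~R :> R by rewrite ltr0z.
have q1 : 1 <= q%:~R :> R by rewrite ler1z; lia.
have -> : alpha - p%:~R / q%:~R = - ((p%:~R - alpha * q%:~R) / q%:~R).
  by field; rewrite gt_eqF.
rewrite normrN normrM normfV (gtr0_norm qr0).
rewrite ltr_pdivrMr ?exprn_gt0// expr2 mulrA mulfVK ?gt_eqF// mulrC gt_min.
have [qN|Nq] := leP q N%:Z.
  by apply/orP; right; have := mP p q q0 qN; nra.
apply/orP; left; rewrite ltNge; apply/negP => le; apply: none.
exists p, q; split=> //; last by rewrite mulrC.
apply: lt_le_trans (truncnS_gt T) _.
by rewrite -[leLHS]/((N.+1)%:Z%:~R) ler_int; lia.
Qed.

(* At the scale t = q of a good approximation p/q, the lattice contains the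
   vector (1, e) with e close to 0; a point off the line through it has
   coordinates x, y with |y - e x| >= 1. *)
Lemma F_t_lower_bound (R : realType) (F : R * R -> R) (alpha : R)
    (p q p' q' : int) :
  is_norm F -> strongly_symmetric F -> coprimez p q -> 0 < q -> 0 < q' ->
  1 <= F_t F q%:~R (q'%:~R, p'%:~R - alpha * q'%:~R) *
       (1 + q%:~R * `|p%:~R - alpha * q%:~R|).
Proof.
move=> F_norm F_sym cop q0 q'0; rewrite /F_t /=.
have qr0 : 0 < q%:~R :> R by rewrite ltr0z.
set e := q%:~R * `|_|; set x := _^-1 * _; set y := _ * (_ - _).
have hx := norm_ge1 F_norm F_sym x y; have hy := norm_ge2 F_norm F_sym x y.
have e0 : 0 <= e by rewrite mulr_ge0// ltW.
have F0 := le_trans (normr_ge0 _) hx.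
(* A vanishing determinant means proportional vectors; coprimality then gives q | q', hence |x| >=
   1. *)
have [j0|jn0] := eqVneq (p' * q - p * q') 0.
  have qq' : q <= q'.
    have : (q %| p * q')%Z.
      by move/eqP: j0; rewrite subr_eq0 => /eqP <-; rewrite dvdz_mull.
    rewrite Gauss_dvdzr; last by rewrite coprimez_sym.
    by rewrite dvdzE => /dvdn_leq; lia.
  have x1 : 1 <= `|x|.
    rewrite (le_trans _ (ler_norm _))// /x ler_pdivlMl// mulr1 ler_int//.
  have F1 := le_trans x1 hx; nra.
have j1 : 1 <= `|y - q%:~R * (p%:~R - alpha * q%:~R) * x|.
  have -> : y - q%:~R * (p%:~R - alpha * q%:~R) * x
      = (p' * q - p * q')%:~R.
    by rewrite /y /x intrB !intrM; field; rewrite gt_eqF.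
  by rewrite -intr_norm ler1z; lia.
have := le_trans j1 (ler_normB _ _).
rewrite (normrM _ x) (normrM _ (_ - _ * q%:~R)) (gtr0_norm qr0) -/e => h.
have := ler_wpM2l e0 hx; lra.
Qed.

Lemma no_solution_infinitely_often (R : realType) (F : R * R -> R)
    (alpha c T : R) :
  is_norm F -> strongly_symmetric F -> well_approximable alpha ->
  c < Delta F -> exists t : R, T < t /\ ~ has_solution F alpha c t.
Proof.
move=> F_norm F_sym wa cD; have D0 := Delta_ge0 F.
(* From f (1 + eta) >= 1 follows f^2 >= 1 - 2 eta, and this choice gives 2 eta [Delta F] <=
   [Delta F] - c. *)
pose eta := (Delta F - c) / (2 * (Delta F + 1)).
have eta0 : 0 < eta by rewrite divr_gt0; lra.
have etaE : eta * (2 * (Delta F + 1)) = Delta F - c by rewrite mulfVK; lra.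
have [p [q [cop q0 Tq le]]] := well_approximable_good T wa eta0.
exists q%:~R; split=> // - [p' [q' [q'0]]].
have := F_t_lower_bound alpha p' F_norm F_sym cop q0 q'0.
set f := F_t _ _ _ => fe; apply/negP; rewrite -leNgt.
have f0 : 0 <= f.
  exact: le_trans (normr_ge0 _) (norm_ge1 F_norm F_sym _ _).
have f1 : 1 <= f * (1 + eta) by nra.
have f2 : 1 - 2 * eta <= f ^+ 2 by nra.
nra.
Qed.

(** * The continued fraction [0; 2, 3, 4, ...] and its convergents *)

(** As in Leibniz's test, the intervals [x_k - d_k, x_k + d_k] meet pairwise; the supremum of their
    left endpoints lies in all of them. *)
Lemma alternating_limit (R : realType) (x d : nat -> R) :
  (forall k, 0 <= d k) -> (forall k, d k.+1 <= d k) ->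
  (forall k, x k.+1 - x k = (-1) ^+ k * d k) ->
  exists a : R, forall k, `|a - x k| <= d k.
Proof.
move=> d0 dS xS.
(* The signed tail from k is [d k] minus the signed tail from k + 1, which by induction lies in
   [0, d_(k+1)]. *)
have bnd n : forall k, 0 <= (-1) ^+ k * (x (k + n)%N - x k) <= d k.
  elim: n => [|n IH] k; first by rewrite addn0 subrr mulr0 lexx d0.
  have := IH k.+1; rewrite addSnnS exprS mulN1r mulNr.
  have -> : x (k + n.+1)%N - x k = (x (k + n.+1)%N - x k.+1) + (x k.+1 - x k).
    by ring.
  rewrite (xS k) [_ * (_ + _ * d k)]mulrDr [_ * (_ * d k)]mulrA -expr2 sqrr_sign.
  rewrite mul1r => /andP[h1 h2].
  by have dk := dS k; apply/andP; split; lra.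
have dist j k : (j <= k)%N -> `|x k - x j| <= d j.
  move=> /subnKC <-; have /andP[h1 h2] := bnd (k - j)%N j.
  by move: h2; rewrite -[X in X <= _]ger0_norm// normrMsign.
have sep j k : x j - d j <= x k + d k.
  have [/dist|/ltnW/dist] := leqP j k; rewrite ler_norml => /andP[];
    by have := d0 j; have := d0 k; lra.
pose E := range (fun j => x j - d j).
have ub k : ubound E (x k + d k) by move=> _ [j _ <-].
exists (sup E) => k; rewrite ler_norml; apply/andP; split.
  rewrite lerBrDl; apply: sup_upper_bound; last by exists k.
  by split; [exists (x 0%N - d 0%N), 0%N | exists (x 0%N + d 0%N)].
rewrite lerBlDl; apply: ge_sup; last exact: ub.
by exists (x 0%N - d 0%N), 0%N.
Qed.

(* Numerators ([a = 0], [b = 1]) and denominators ([a = 1], [b = 2]) of the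
   convergents of the continued fraction [0; 2, 3, 4, ...]. *)
Fixpoint continuant (a b n : nat) : nat :=
  if n is n'.+1 then
    if n' is n''.+1 then (n.+1 * continuant a b n' + continuant a b n'')%N
    else b
  else a.

Local Notation cp := (continuant 0 1).
Local Notation cq := (continuant 1 2).

Lemma continuantSS a b n : continuant a b n.+2 =
  (n.+3 * continuant a b n.+1 + continuant a b n)%N.
Proof. by []. Qed.

Lemma cq_growth n : (n.+2 * cq n <= cq n.+1)%N.
Proof. by case: n => // n; rewrite continuantSS leq_addr. Qed.

Lemma cq_gt n : (n < cq n)%N.
Proof. by elim: n => // n IH; have := cq_growth n; nia. Qed.

Lemma continuant_det n :
  (cp n.+1)%:Z * (cq n)%:Z - (cp n)%:Z * (cq n.+1)%:Z = (-1) ^+ n.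
Proof.
elim: n => // n IH; rewrite !continuantSS exprS -IH !PoszD !PoszM; ring.
Qed.

Lemma locate (R : realType) (u : nat -> R) (K : nat) (t : R) :
  (exists n, t < u (K + n)%N) -> u K <= t ->
  exists2 k, (K <= k)%N & u k <= t < u k.+1.
Proof.
move=> ex uK; case: (ex_minnP ex) => -[|n] lt min.
  by move: lt; rewrite addn0 ltNge uK.
exists (K + n)%N; first exact: leq_addr.
by rewrite -addnS lt andbT leNgt; apply/negP => /min; rewrite ltnn.
Qed.

Lemma cq_gt0 (R : realType) n : 0 < (cq n)%:R :> R.
Proof. by rewrite ltr0n; have := cq_gt n; lia. Qed.

Lemma cq_growthr (R : realType) n : n.+2%:R * (cq n)%:R <= (cq n.+1)%:R :> R.
Proof. by rewrite -natrM ler_nat cq_growth. Qed.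

Definition convergent_limit (R : realType) (a : R) : Prop :=
  forall k, `|(cp k)%:R - a * (cq k)%:R| <= (cq k.+1)%:R^-1.

Lemma convergent_limit_exists (R : realType) : exists a : R, convergent_limit a.
Proof.
pose x k : R := (cp k)%:R / (cq k)%:R.
pose d k : R := (cq k)%:R^-1 / (cq k.+1)%:R.
have q0 n : 0 < (cq n)%:R :> R := cq_gt0 R n.
have qn0 n : (cq n)%:R != 0 :> R by rewrite gt_eqF.
have [k|k|k|a aP] := @alternating_limit R x d.
- by rewrite /d divr_ge0// invr_ge0 ltW.
- rewrite /d mulrC ler_pM2r ?invr_gt0// lef_pV2 ?posrE//.
  by rewrite ler_nat; have := cq_growth k; have := cq_growth k.+1; nia.
(* Dividing the determinant identity by q_k q_(k+1) gives the alternating differences. *)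
- have := congr1 (fun z : int => z%:~R : R) (continuant_det k).
  rewrite rmorphXn /= intrB !intrM -!pmulrn => <-.
  by rewrite /x /d; field; rewrite !qn0.
exists a => k; have := aP k.
rewrite -(ler_pM2r (q0 k)) -{1}(gtr0_norm (q0 k)) -normrM distrC mulrBl.
by rewrite /x /d mulfVK// mulrAC mulVf// mul1r distrC.
Qed.

(** If a = n/b, the integer p_k b - n q_k has size at most b / q_(k+1) < 1 for k >= b, so it is 0;
    two consecutive zeros contradict [continuant_det]. *)
Lemma convergent_limit_irrational (R : realType) (a : R) :
  convergent_limit a -> irrational a.
Proof.
move=> aP [r _ ra].
pose n := numq r; pose b := denq r; have b0 : 0 < b := denq_gt0 r.
have br0 : 0 < b%:~R :> R by rewrite ltr0z.
have aE : a = n%:~R / b%:~R by rewrite -ra.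
have eq0 k : (`|b| <= k)%N -> (cp k)%:Z * b = n * (cq k)%:Z.
  move=> bk; apply/eqP; rewrite -subr_eq0 -normr_le0.
  suff : `|(cp k)%:Z * b - n * (cq k)%:Z| < 1 by lia.
  rewrite -(ltr_int R) intr_norm.
  have -> : ((cp k)%:Z * b - n * (cq k)%:Z)%:~R =
      ((cp k)%:R - a * (cq k)%:R) * b%:~R :> R.
    by rewrite intrB !intrM -!pmulrn aE; field; rewrite gt_eqF.
  rewrite normrM (gtr0_norm br0).
  apply: (@le_lt_trans _ _ ((cq k.+1)%:R^-1 * b%:~R)).
    by rewrite ler_pM2r.
  rewrite mulrC ltr_pdivrMr ?cq_gt0// mul1r.
  have := cq_gt k.+1; rewrite -[ltRHS]/((cq k.+1)%:Z%:~R) ltr_int; lia.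
have := continuant_det `|b|%N; have := eq0 _ (leqnn _); have := eq0 _ (leqnSn _).
set k := `|b|%N => e1 e0 /(congr1 ( *%R b)).
have -> : b * ((cp k.+1)%:Z * (cq k)%:Z - (cp k)%:Z * (cq k.+1)%:Z) =
  ((cp k.+1)%:Z * b) * (cq k)%:Z - ((cp k)%:Z * b) * (cq k.+1)%:Z by ring.
rewrite e0 e1 -!mulrA [(cq k)%:Z * _]mulrC subrr => /esym/eqP.
by rewrite mulf_eq0 signr_eq0 orbF gt_eqF.
Qed.

Lemma convergent_limit_well_approximable (R : realType) (a : R) :
  convergent_limit a -> well_approximable a.
Proof.
move=> aP; split; first exact: convergent_limit_irrational.
move=> [_ [c [c0 bad]]].
(* Since q_k |p_k - a q_k| <= q_k / q_(k+1) <= 1/(k+2), an index with k + 2 > 1/c refutes [bad]. *)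
pose k := Num.trunc c^-1.
have kc : 1 < c * k.+2%:R.
  rewrite -ltr_pdivrMl// mulr1; apply: lt_trans (truncnS_gt _) _.
  by rewrite ltr_nat.
have qr0 := cq_gt0 R k.
have cop : coprimez (cp k)%:Z (cq k)%:Z.
  apply/coprimezP; exists (- (-1) ^+ k * (cq k.+1)%:Z, (-1) ^+ k * (cp k.+1)%:Z).
  rewrite /= -[RHS](sqrr_sign _ k) expr2 -[X in _ = _ * X]continuant_det; ring.
have := bad _ _ cop; rewrite ltz_nat -(ltr0n R) => /(_ qr0).
rewrite -!pmulrn; apply/negP; rewrite -leNgt.
have -> : a - (cp k)%:R / (cq k)%:R = - (((cp k)%:R - a * (cq k)%:R) / (cq k)%:R).
  by field; rewrite gt_eqF.
rewrite normrN normrM normfV (gtr0_norm qr0) expr2 invfM mulrA ler_pM2r ?invr_gt0//.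
apply: le_trans (aP k) _.
rewrite -[leLHS]mul1r ler_pdivrMr ?cq_gt0// mulrAC ler_pdivlMr// mul1r.
have := cq_growthr R k; nra.
Qed.

(* On [q_k, q_(k+1)] the convex function t |-> q_k / t + t / q_(k+1) is largest
   at the endpoints, where it equals 1 + q_k / q_(k+1). *)
Lemma convergent_limit_solution (R : realType) (F : R * R -> R) (a c : R) :
  is_norm F -> strongly_symmetric F -> convergent_limit a ->
  Delta F < c -> \forall t \near +oo, has_solution F a c t.
Proof.
move=> F_norm F_sym aP Dc; have D0 := Delta_ge0 F.
(* For k >= K the error 3 [Delta F] / (k+2) is then less than c - [Delta F]. *)
pose K := Num.trunc (3 * Delta F / (c - Delta F)).
have KD : 3 * Delta F < (c - Delta F) * K.+1%:R.
  by rewrite -ltr_pdivrMl ?subr_gt0// mulrC truncnS_gt.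
exists (cq K)%:R; split=> // t Kt.
have [||k Kk /andP[kt tk]] := @locate R (fun n => (cq n)%:R) K t.
- exists (Num.trunc t); apply: lt_le_trans (truncnS_gt t) _.
  by rewrite ler_nat; apply: leq_ltn_trans (leq_addl _ _) (cq_gt _).
- exact: ltW.
exists (cp k)%:Z, (cq k)%:Z; split.
  by rewrite ltz_nat; have := cq_gt k; lia.
rewrite /F_t /= -!pmulrn.
set x := t^-1 * _; set y := t * _.
have q0 := cq_gt0 R k; have q1 := cq_gt0 R k.+1.
have t0 : 0 < t by exact: lt_le_trans kt.
have h1 := norm_le_l1 F_norm F_sym x y.
have h0 := le_trans (normr_ge0 _) (norm_ge1 F_norm F_sym x y).
have hx : `|x| = (cq k)%:R / t by rewrite /x gtr0_norm ?mulr_gt0 ?invr_gt0// mulrC.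
have hy : `|y| <= t / (cq k.+1)%:R.
  by rewrite /y normrM gtr0_norm// ler_pM2l.
pose e : R := k.+2%:R^-1.
have e0 : 0 < e by rewrite invr_gt0.
have e1 : e <= 1 by rewrite invf_le1// ler1n.
(* Expanding (1 - u)(1 - v) >= 0 gives u + v <= 1 + uv, where uv = q_k / q_(k+1) no longer involves
   [t]. *)
have xy : (cq k)%:R / t + t / (cq k.+1)%:R <= 1 + e.
  have u0 : 0 <= 1 - (cq k)%:R / t by rewrite subr_ge0 ler_pdivrMr// mul1r.
  have v0 : 0 <= 1 - t / (cq k.+1)%:R.
    by rewrite subr_ge0 ler_pdivrMr// mul1r ltW.
  have ww : (cq k)%:R / t * (t / (cq k.+1)%:R) = (cq k)%:R / (cq k.+1)%:R :> R.
    by field; rewrite !gt_eqF.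
  have we : (cq k)%:R / (cq k.+1)%:R <= e.
    rewrite ler_pdivrMr// /e ler_pdivlMl//; exact: cq_growthr.
  have := mulr_ge0 u0 v0; nra.
have f1 : F (x, y) <= 1 + e by lra.
have f2 : F (x, y) ^+ 2 <= 1 + 3 * e by nra.
have De : 3 * Delta F * e < c - Delta F.
  rewrite /e ltr_pdivrMr//; apply: lt_le_trans KD _.
  by rewrite ler_pM2l ?subr_gt0// ler_nat ltnS leqW.
nra.
Qed.

Theorem theorem3 (R : realType) (F : R * R -> R)
    (F_norm : is_norm F) (F_sym : strongly_symmetric F) :
  (forall alpha : R, well_approximable alpha -> Delta F <= delta F alpha) /\
  (exists alpha : R, well_approximable alpha /\ delta F alpha = Delta F).
Proof.
split=> [alpha wa|].
  rewrite leNgt; apply/negP => dD.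
  have [h _] := delta_propertyP F_norm F_sym alpha.
  (* At the midpoint, solutions would exist for all large [t] and yet fail for arbitrarily large
     [t]. *)
  have /h [M [_ sol]] : delta F alpha < (delta F alpha + Delta F) / 2 by lra.
  have lt : (delta F alpha + Delta F) / 2 < Delta F by lra.
  have [t [Mt]] := no_solution_infinitely_often M F_norm F_sym wa lt.
  by apply; apply: sol.
have [a aP] := convergent_limit_exists R.
have wa := convergent_limit_well_approximable aP.
exists a; split=> //; apply: deltaE; split=> [c|c cD T].
  exact: convergent_limit_solution.
exact: no_solution_infinitely_often.
Qed.
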